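(* The cyclic $\mathbf G$-span of the vector $\Xi=\xi^{\otimes\infty}\in H$ (the closed linear span of the vectors $\rho(g)\Xi$, $g\in\mathbf G$) is an irreducible representation of $\mathbf G$.
   Context: $S_\infty$ is the group of finitely supported permutations of $\mathbb N$, $\overline S_\infty$ is the group of all permutations of $\mathbb N$. The trisymmetric group $\mathbf G\subset\overline S_\infty\times\overline S_\infty\times\overline S_\infty$ consists of triples $(g_{red},g_{yellow},g_{blue})$ with $g_{red}g_{yellow}^{-1},\,g_{yellow}g_{blue}^{-1}\in S_\infty$; it is generated by $G=S_\infty\times S_\infty\times S_\infty$ and the diagonal $\mathbf K=\{(g,g,g):g\in\overline S_\infty\}$. Let $V_{red},V_{yellow},V_{blue}$ be arbitrary (finite- or infinite-dimensional) Hilbert spaces, $X=V_{red}\otimes V_{yellow}\otimes V_{blue}$, and let $\xi\in X$ be any unit vector. Let $H=(X,\xi)\otimes(X,\xi)\otimes\cdots$ be the countable tensor product with distinguished vectors $\xi$: if $e_1=\xi,e_2,\dots$ is an orthonormal basis of $X$, then $H$ has the orthonormal basis of formal vectors $e_{k_1}\otimes e_{k_2}\otimes\cdots$ with $k_j=1$ for all but finitely many $j$. Put $\Xi=\xi\otimes\xi\otimes\cdots$. The unitary representation $\rho$ of $\mathbf G$ in $H$: the first copy of $S_\infty$ in $G$ acts by permutations of the factors $V_{red}$, the second copy by permutations of the factors $V_{yellow}$, the third copy by permutations of the factors $V_{blue}$; the subgroup $\mathbf K\simeq\overline S_\infty$ acts by permutations of the factors $(X,\xi)$. (A permutation $g$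 moves the factor in position $m$ to position $g(m)$.) *)

(* Defs.v *)
From HB Require Import structures.
From mathcomp Require Import all_boot all_order all_algebra.
From mathcomp Require Import sesquilinear.
From mathcomp Require Import complex.
From mathcomp Require Import all_classical all_reals.
From mathcomp Require Import topology normedtype.

Set Implicit Arguments.
Unset Strict Implicit.
Unset Printing Implicit Defensive.

Import Order.TTheory GRing.Theory Num.Theory Num.Def.
Import numFieldNormedType.Exports.
Local Open Scope classical_set_scope.
Local Open Scope ring_scope.
Local Open Scope complex_scope.

(* The form is linear in its first argument and conjugate-linear in the
   second one. Neither separability nor infinite dimension is required. *)
HB.mixin Record CompleteNormedModule_isHilbert (R : realType) V
    of CompleteNormedModule R[i] V := {
  hdot : {dot V for (@conjC R[i])} ;
  sqr_hnorm : forall x : V, `|x| ^+ 2 = hdot x x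
}.

#[short(type="hilbertType")]
HB.structure Definition Hilbert (R : realType) :=
  {V of CompleteNormedModule_isHilbert R V & CompleteNormedModule R[i] V}.

Definition lin_span (R : realType) (H : hilbertType R) (A : set H) : set H :=
  [set u | exists n (c : 'I_n -> R[i]) (v : 'I_n -> H),
     (forall i, A (v i)) /\ u = \sum_(i < n) c i *: v i].

Definition closed_span (R : realType) (H : hilbertType R) (A : set H) : set H :=
  closure (lin_span A).

Definition orthonormal_basis (R : realType) (H : hilbertType R) (J : Type)
    (D : set J) (f : J -> H) : Prop :=
  (forall j k, D j -> D k -> hdot (f j) (f k) = (`[< j = k >])%:R) /\
  closed_span (f @` D) = setT.

(* [t] exhibits [X] as the Hilbert space tensor product of the three spaces;
   this determines [(X, t)] up to a unique unitary isomorphism. *)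
Record is_hilbert_tensor3 (R : realType) (V1 V2 V3 X : hilbertType R)
    (t : V1 -> V2 -> V3 -> X) : Prop := {
  tensor3_linear1 : forall b c, linear (fun a => t a b c) ;
  tensor3_linear2 : forall a c, linear (fun b => t a b c) ;
  tensor3_linear3 : forall a b, linear (fun c => t a b c) ;
  tensor3_dot : forall a a' b b' c c',
    hdot (t a b c) (t a' b' c') = hdot a a' * hdot b b' * hdot c c' ;
  tensor3_total :
    closed_span [set x | exists a b c, x = t a b c] = setT
}.

Definition update (X : Type) (x : nat -> X) (m : nat) (u : X) : nat -> X :=
  fun j => if j == m then u else x j.

(* [T x] is the vector x_0 (x) x_1 (x) ... ; it is meaningful only when
   [x j = xi] for all but finitely many j, and nothing is assumed about the
   other values of [T]. [e] is an orthonormal basis of [X] with [e i0 = xi]. *)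
Record is_countable_tensor (R : realType) (X H : hilbertType R) (xi : X)
    (I : Type) (e : I -> X) (i0 : I) (T : (nat -> X) -> H) : Prop := {
  ctensor_linear : forall (x : nat -> X) m, (\forall j \near \oo, x j = xi) ->
    linear (fun u => T (update x m u)) ;
  ctensor_dot : forall (x y : nat -> X) n,
    (forall j, (n <= j)%N -> x j = xi /\ y j = xi) ->
    hdot (T x) (T y) = \prod_(j < n) hdot (x j) (y j) ;
  ctensor_basis :
    orthonormal_basis [set k : nat -> I | \forall j \near \oo, k j = i0]
      (fun k => T (e \o k))
}.

(* The group of all permutations of nat. *)
Record symN := SymN {
  symN_fun :> nat -> nat ;
  symN_inv : nat -> nat ;
  symN_funK : cancel symN_fun symN_inv ;
  symN_invK : cancel symN_inv symN_fun
}.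

HB.instance Definition _ := gen_eqMixin symN.
HB.instance Definition _ := gen_choiceMixin symN.

Lemma symN_ext (g h : symN) : g =1 h -> g = h.
Proof.
case: g h => [f f' fK f'K] [k k' kK k'K] /= /funext fk; subst k.
have E : f' = k' by apply/funext => n; rewrite -{1}(k'K n) fK.
subst k'; congr SymN; exact: Prop_irrelevance.
Qed.

Definition symN_one : symN := @SymN id id (fun=> erefl) (fun=> erefl).

Definition symN_mul (g h : symN) : symN :=
  SymN (can_comp (symN_funK g) (symN_funK h))
       (can_comp (symN_invK h) (symN_invK g)).

Definition symN_opp (g : symN) : symN := SymN (symN_invK g) (symN_funK g).

Lemma symN_mulA : associative symN_mul.
Proof. by move=> f g h; apply: symN_ext. Qed.

Lemma symN_mul1 : left_id symN_one symN_mul.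
Proof. by move=> f; apply: symN_ext. Qed.

Lemma symN_mulr1 : right_id symN_one symN_mul.
Proof. by move=> f; apply: symN_ext. Qed.

Lemma symN_mulV : left_inverse symN_one symN_opp symN_mul.
Proof. by move=> f; apply: symN_ext => n /=; rewrite symN_funK. Qed.

Lemma symN_mulrV : right_inverse symN_one symN_opp symN_mul.
Proof. by move=> f; apply: symN_ext => n /=; rewrite symN_invK. Qed.

HB.instance Definition _ := isGroup.Build symN
  symN_mulA symN_mul1 symN_mulr1 symN_mulV symN_mulrV.

Definition finitary (g : symN) : Prop := finite_set [set n | g n <> n].

Lemma finitary1 : finitary 1%g.
Proof.
by rewrite /finitary (_ : [set n | _] = set0) // -subset0 => n /(_ erefl).
Qed.

Lemma finitaryM (g h : symN) : finitary g -> finitary h -> finitary (g * h)%g.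
Proof.
move=> fg fh; apply: (@sub_finite_set _ _ ([set n | g n <> n] `|` [set n | h n <> n])).
  move=> n /= ghn; have [hn|] := pselect (h n = n); last by right.
  by left => gn; apply: ghn; rewrite -[RHS]gn -[in RHS]hn.
by rewrite finite_setU.
Qed.

Lemma finitaryV (g : symN) : finitary g -> finitary g^-1%g.
Proof.
apply: sub_finite_set => n /= gVn gn; apply: gVn.
by rewrite -[in LHS]gn; exact: symN_funK.
Qed.

(* g * s * g^-1 is supported on the image under g of the support of s. *)
Lemma finitaryJ (g s : symN) : finitary s -> finitary (g * s * g^-1)%g.
Proof.
move=> fs; apply: (@sub_finite_set _ _ (g @` [set n | s n <> n])).
  move=> n /= gsn; exists ((g^-1)%g n); last exact: symN_invK.
  move=> sn; apply: gsn; rewrite -[RHS](symN_invK g).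
  by congr (g _).
exact: finite_image.
Qed.

(* The trisymmetric group; a triple is (red, yellow, blue). *)
Definition trisym_pred : {pred symN * symN * symN} :=
  [pred g | `[< finitary (g.1.1 * g.1.2^-1)%g /\
                finitary (g.1.2 * g.2^-1)%g >]].

Lemma trisym_closed : group_closed trisym_pred.
Proof.
split; first by apply/asboolP; rewrite /= !mulgV; split; exact: finitary1.
have aux (a b c d : symN) : finitary (a * b^-1)%g -> finitary (c * d^-1)%g ->
    finitary ((a * c^-1) * (b * d^-1)^-1)%g.
  move=> fab fcd.
  have -> : ((a * c^-1) * (b * d^-1)^-1 =
      (a * b^-1) * (b * (c^-1 * d) * b^-1))%g.
    by rewrite invgM invgK !mulgA mulgVK.
  apply: finitaryM => //; apply: finitaryJ.
  have -> : (c^-1 * d = c^-1 * (d * c^-1) * c^-1^-1)%g.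
    by rewrite invgK !mulgA mulgVK.
  apply: finitaryJ; have -> : (d * c^-1 = (c * d^-1)^-1)%g.
    by rewrite invgM invgK.
  exact: finitaryV.
move=> [[r y] b] [[r' y'] b'] /asboolP[/= ry yb] /asboolP[/= ry' yb'].
by apply/asboolP; split; exact: aux.
Qed.

Record trisym := Trisym {
  trival : symN * symN * symN ;
  trivalP : trival \in trisym_pred
}.

HB.instance Definition _ := [isSub for trival].
HB.instance Definition _ := [Choice of trisym by <:].
HB.instance Definition _ := SubChoice_isSubGroup.Build
  (symN * symN * symN)%type trisym_pred trisym trisym_closed.

Record is_unitary_rep (R : realType) (G : groupType) (H : hilbertType R)
    (rho : G -> H -> H) : Prop := {
  urep_linear : forall g, linear (rho g) ;
  urep_dot : forall g u v, hdot (rho g u) (rho g v) = hdot u v ;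
  urep1 : forall u, rho 1%g u = u ;
  urepM : forall g h u, rho (g * h)%g u = rho g (rho h u)
}.

Record is_closed_invariant (R : realType) (G : groupType) (H : hilbertType R)
    (rho : G -> H -> H) (W : set H) : Prop := {
  invariant_closed : closed W ;
  invariant0 : W 0 ;
  invariant_lin : forall (a : R[i]) u v, W u -> W v -> W (a *: u + v) ;
  invariant_rep : forall g u, W u -> W (rho g u)
}.

Definition cyclic_span (R : realType) (G : groupType) (H : hilbertType R)
    (rho : G -> H -> H) (v : H) : set H :=
  closed_span [set rho g v | g in [set: G]].

(* The restriction of [rho] to the subspace [W] is irreducible. *)
Record is_irreducible_on (R : realType) (G : groupType) (H : hilbertType R)
    (rho : G -> H -> H) (W : set H) : Prop := {
  irr_invariant : is_closed_invariant rho W ;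
  irr_neq0 : W <> [set 0] ;
  irr_minimal : forall U : set H, is_closed_invariant rho U -> U `<=` W ->
    U = [set 0] \/ U = W
}.

(* A finitary permutation [s] of one colour is prescribed on the vectors
   x_0 (x) x_1 (x) ... whose factors in the support of [s] are decomposable,
   x_j = a_j (x) b_j (x) c_j; the other factors are arbitrary and stay in
   place. Such vectors are total in [H]. Position j of the image receives the
   factor that was in position s^-1 j, so that s moves m to s m. *)
Record is_trisym_action (R : realType) (Vr Vy Vb X H : hilbertType R)
    (t : Vr -> Vy -> Vb -> X) (xi : X) (T : (nat -> X) -> H)
    (rho : trisym -> H -> H) : Prop := {
  act_red : forall (g : trisym) (s : symN) a b c (x y : nat -> X),
    trival g = (s, 1%g, 1%g) ->
    (\forall j \near \oo, x j = xi) ->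
    (forall j, s j <> j -> x j = t (a j) (b j) (c j)) ->
    (forall j, s j <> j -> y j = t (a ((s^-1)%g j)) (b j) (c j)) ->
    (forall j, s j = j -> y j = x j) ->
    rho g (T x) = T y ;
  act_yellow : forall (g : trisym) (s : symN) a b c (x y : nat -> X),
    trival g = (1%g, s, 1%g) ->
    (\forall j \near \oo, x j = xi) ->
    (forall j, s j <> j -> x j = t (a j) (b j) (c j)) ->
    (forall j, s j <> j -> y j = t (a j) (b ((s^-1)%g j)) (c j)) ->
    (forall j, s j = j -> y j = x j) ->
    rho g (T x) = T y ;
  act_blue : forall (g : trisym) (s : symN) a b c (x y : nat -> X),
    trival g = (1%g, 1%g, s) ->
    (\forall j \near \oo, x j = xi) ->
    (forall j, s j <> j -> x j = t (a j) (b j) (c j)) ->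
    (forall j, s j <> j -> y j = t (a j) (b j) (c ((s^-1)%g j))) ->
    (forall j, s j = j -> y j = x j) ->
    rho g (T x) = T y ;
  act_diag : forall (g : trisym) (s : symN) (x : nat -> X),
    trival g = (s, s, s) ->
    (\forall j \near \oo, x j = xi) ->
    rho g (T x) = T (fun j => x ((s^-1)%g j))
}.

(* Main.v *)
Require Import Defs.
From HB Require Import structures.
From mathcomp Require Import all_boot all_order all_algebra.
From mathcomp Require Import sesquilinear.
From mathcomp Require Import complex.
From mathcomp Require Import all_classical all_reals.
From mathcomp Require Import topology normedtype.
From mathcomp Require Import zify.

Set Implicit Arguments.
Unset Strict Implicit.
Unset Printing Implicit Defensive.

Import Order.TTheory GRing.Theory Num.Theory Num.Def.
Import numFieldNormedType.Exports.
Local Open Scope classical_set_scope.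
Local Open Scope ring_scope.
Local Open Scope complex_scope.

(** Write [Xi] for the vector xi (x) xi (x) ..., and let [U] be a closed
    invariant subspace of its cyclic span.

    The heart of the matter is that the diagonal permutations alone contract
    [H] to the line of [Xi]: for every [u] some averages of the vectors
    rho(s) u, with s diagonal, come arbitrarily close to <u, Xi> Xi.  It is
    enough to see this for u orthogonal to [Xi], up to a small error, so one
    may take for u a combination of tensors which differ from [Xi] only in the
    positions below some N.  Diagonal permutations s_0, s_1, ... carrying
    [0, N) to pairwise disjoint blocks give
    <rho(s_i) u, rho(s_k) u> = <u, Xi> <Xi, u> = 0 for i != k
    ([hdot_rho_disjoint]), because in each position at least one of the two
    factors is xi.  The average of n pairwise orthogonal vectors of the same
    norm r has norm r / sqrt n, which tends to 0 ([averages_small]).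

    Irreducibility follows ([irreducible_of_averages]).  As [U] is closed and
    invariant, it contains <u, Xi> Xi for each u in [U].  Either some <u, Xi>
    is nonzero, and then [U] contains [Xi], hence its whole cyclic span; or
    [U] is orthogonal to [Xi], hence by invariance to all the vectors
    rho(g) Xi, hence to the closed span of these, which contains [U]: then
    [U] is zero.  Averaging replaces the orthogonal projection of [Xi] on [U]
    and the description of the vectors fixed by the diagonal subgroup. *)

(** * Closed spans and orthogonality in a Hilbert space *)

Lemma complex_archimedean (R : realType) (r e : R[i]) : 0 <= r -> 0 < e ->
  exists n : nat, r < n.+1%:R * e.
Proof.
move=> r0 e0.
have rE : r = (complex.Re r)%:C by rewrite RRe_real // ger0_real.
have eE : e = (complex.Re e)%:C by rewrite RRe_real // gtr0_real.
move: r0 e0; rewrite rE eE; set a := complex.Re r; set b := complex.Re e.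
rewrite lecR ltcR => a0 b0; exists (Num.trunc (a / b)).
rewrite (_ : _%:R = (Num.trunc (a / b)).+1%:R%:C); last by rewrite rmorph_nat.
rewrite -rmorphM ltcR -ltr_pdivrMr //.
exact: truncnS_gt.
Qed.

Section HilbertSpace.
Context (R : realType) (H : hilbertType R).
Implicit Types (A B : set H) (u v w : H) (a : R[i]).

Lemma closure_normP A u :
  closure A u <-> forall e : R[i], 0 < e -> exists2 w, A w & `|u - w| < e.
Proof.
split=> [cu e e0|h B /nbhs_ballP[e /= e0 eB]].
  have [w [Aw]] := cu (ball u e) (nbhsx_ballx _ _ e0).
  by rewrite -ball_normE; exists w.
have [w Aw uw] := h e e0; exists w; split => //.
by apply: eB; rewrite -ball_normE.
Qed.

Lemma normD_orth u v : hdot u v = 0 -> `|u + v| ^+ 2 = `|u| ^+ 2 + `|v| ^+ 2.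
Proof. by move=> uv; rewrite !sqr_hnorm hnormDd. Qed.

(** Pythagoras: u is the orthogonal sum of u - <u, v> v and <u, v> v. *)
Lemma norm_reject_le u v : `|v| = 1 -> `|u - hdot u v *: v| <= `|u|.
Proof.
move=> v1; have vv : hdot v v = 1 by rewrite -sqr_hnorm v1 expr1n.
have orth : hdot (u - hdot u v *: v) (hdot u v *: v) = 0.
  by rewrite linearZr /= linearBl linearZl_LR /= vv mulr1 subrr mulr0.
have := normD_orth orth; rewrite subrK => normu.
by rewrite -ler_sqr ?nnegrE ?normr_ge0 // normu lerDl exprn_ge0.
Qed.

Lemma norm_sum_orth n (f : nat -> H) (r : R[i]) :
    (forall i j, i != j -> hdot (f i) (f j) = 0) ->
    (forall i, `|f i| = r) ->
  `|\sum_(i < n) f i| ^+ 2 = n%:R * r ^+ 2.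
Proof.
move=> fo fr; elim: n => [|n IHn]; first by rewrite big_ord0 normr0 expr0n mul0r.
rewrite big_ord_recr /= normD_orth ?IHn ?fr; last first.
  by rewrite linear_sumlz big1 //= => i _; rewrite fo // ltn_eqF.
by rewrite -natr1 mulrDl mul1r.
Qed.

Lemma lin_span_ind A (P : H -> Prop) : P 0 ->
    (forall a u v, A u -> P v -> P (a *: u + v)) ->
  forall w, lin_span A w -> P w.
Proof.
move=> P0 PD w [n [c [v [Av ->]]]].
elim: n c v Av => [|n IHn] c v Av; first by rewrite big_ord0.
by rewrite big_ord_recl; apply: PD => //; apply: (IHn (c \o lift ord0)) => i.
Qed.

Lemma lin_span0 A : lin_span A 0.
Proof. by exists 0%N, (fun=> 0), (fun=> 0); split=> [[]|]; rewrite ?big_ord0. Qed.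

Lemma lin_span_gen A a u v : A u -> lin_span A v -> lin_span A (a *: u + v).
Proof.
move=> Au [n [c [w [Aw ->]]]].
exists n.+1, (oapp c a \o unlift ord0), (oapp w u \o unlift ord0); split.
  by move=> i /=; case: unlift => /=.
rewrite big_ord_recl /= unlift_none /=; congr (_ + _).
by apply: eq_bigr => i _ /=; rewrite liftK.
Qed.

Lemma lin_spanP A a u v : lin_span A u -> lin_span A v -> lin_span A (a *: u + v).
Proof.
move=> Au Av; elim/lin_span_ind : Au => [|b w z Aw IH]; first by rewrite scaler0 add0r.
by rewrite scalerDr scalerA -addrA; apply: lin_span_gen.
Qed.

Lemma lin_span_sub A u : A u -> lin_span A u.
Proof. by move=> Au; rewrite -[u]scale1r -[_ *: u]addr0; apply/lin_span_gen/lin_span0. Qed.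

Lemma lin_spanS A B : A `<=` B -> lin_span A `<=` lin_span B.
Proof.
move=> AB u; elim/lin_span_ind => [|a v w /AB Bv]; first exact: lin_span0.
exact: lin_span_gen.
Qed.

(** If w in the span of [A] is close to u, then u and w are orthogonal, so
    |u| <= |u - w| by Pythagoras. *)
Lemma orth_closed_span A u :
  (forall v, A v -> hdot u v = 0) -> closed_span A u -> u = 0.
Proof.
move=> uA /closure_normP cu; apply/eqP; rewrite -normr_le0; apply/ler_addgt0Pr => e e0.
rewrite add0r; have [w Aw uw] := cu e e0.
have : hdot u w = 0.
  elim/lin_span_ind : Aw {uw} => [|a v z Av IH]; first by rewrite linear0r.
  by rewrite linearPr /= uA // IH mulr0 addr0.
move=> uw0; apply/ltW/(le_lt_trans _ uw).
rewrite -ler_sqr ?nnegrE ?normr_ge0 // normD_orth ?lerDl ?exprn_ge0 //.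
by rewrite linearNr /= uw0 oppr0.
Qed.

End HilbertSpace.

(** * Unitary representations and irreducibility of a cyclic span *)

Section UnitaryRepresentation.
Context (R : realType) (G : groupType) (H : hilbertType R) (rho : G -> H -> H).
Hypothesis hrho : is_unitary_rep rho.

Lemma urepD g u v : rho g (u + v) = rho g u + rho g v.
Proof. by have := urep_linear hrho g 1 u v; rewrite !scale1r. Qed.

Lemma urep0 g : rho g 0 = 0.
Proof. by apply: (addrI (rho g 0)); rewrite -urepD !addr0. Qed.

Lemma urepZ g a u : rho g (a *: u) = a *: rho g u.
Proof. by have := urep_linear hrho g a u 0; rewrite urep0 !addr0. Qed.

Lemma urepB g u v : rho g (u - v) = rho g u - rho g v.
Proof. by rewrite urepD -scaleN1r urepZ scaleN1r. Qed.

Lemma urep_norm g u : `|rho g u| = `|u|.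
Proof.
apply/eqP; rewrite -(@eqrXn2 _ 2) ?normr_ge0 //.
by rewrite !sqr_hnorm (urep_dot hrho).
Qed.

Lemma closed_span_invariant (A : set H) : (forall g u, A u -> A (rho g u)) ->
  is_closed_invariant rho (closed_span A).
Proof.
move=> GA; split.
- exact: closed_closure.
- exact/subset_closure/lin_span0.
- move=> a u v /closure_normP cu /closure_normP cv; apply/closure_normP => e e0.
  (* The tolerance for u is divided by |a| + 1 since a may vanish. *)
  have a0 : 0 < `|a| + 1 by rewrite ltr_wpDl.
  have [w Aw uw] := cu (e / 2 / (`|a| + 1)) ltac:(by rewrite !divr_gt0).
  have [z Az vz] := cv (e / 2) ltac:(by rewrite divr_gt0).
  exists (a *: w + z); first exact: lin_spanP.
  rewrite opprD addrACA -scalerBr (splitr e).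
  apply: (le_lt_trans (ler_normD _ _)); apply: ler_ltD => //.
  rewrite normrZ; apply: (@le_trans _ _ ((`|a| + 1) * `|u - w|)).
    by rewrite ler_wpM2r // lerDl.
  by rewrite mulrC -ler_pdivlMr // ltW.
- move=> g u /closure_normP cu; apply/closure_normP => e /cu[w Aw uw].
  exists (rho g w); last by rewrite -urepB urep_norm.
  elim/lin_span_ind : Aw {uw} => [|a v z Av]; first by rewrite urep0; exact: lin_span0.
  by rewrite urepD urepZ; apply: lin_span_gen; exact: GA.
Qed.

Lemma cyclic_span_invariant v : is_closed_invariant rho (cyclic_span rho v).
Proof.
apply: closed_span_invariant => g u [h _ <-]; exists (g * h)%g => //.
by rewrite (urepM hrho).
Qed.

Lemma cyclic_span_gen v : cyclic_span rho v v.
Proof.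
by apply/subset_closure/lin_span_sub; exists 1%g => //; rewrite (urep1 hrho).
Qed.

Lemma cyclic_span_min v (U : set H) :
  is_closed_invariant rho U -> U v -> cyclic_span rho v `<=` U.
Proof.
move=> [Uc U0 Ul Ur] Uv; rewrite /cyclic_span /closed_span.
rewrite ((closure_id U).1 Uc); apply: closure_subset => w.
by elim/lin_span_ind => // a u z [g _ <-]; apply: Ul; exact: Ur.
Qed.

(** The averages are taken over group elements that fix v, so applied to an
    arbitrary u they send the component <u, v> v to itself and make the
    component orthogonal to v small.  A closed invariant subspace which
    contains u therefore contains <u, v> v. *)
Lemma irreducible_of_averages (v : H) : `|v| = 1 ->
    (forall (u : H) (e : R[i]), hdot u v = 0 -> 0 < e -> exists n (g : nat -> G),
      (forall i, rho (g i) v = v) /\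
      `|n.+1%:R^-1 *: \sum_(i < n.+1) rho (g i) u| < e) ->
  is_irreducible_on rho (cyclic_span rho v).
Proof.
move=> v1 avg; split.
- exact: cyclic_span_invariant.
- move=> W0; have : cyclic_span rho v v by exact: cyclic_span_gen.
  rewrite W0 /= => v0.
  by move: v1; rewrite v0 normr0 => /esym/eqP; rewrite oner_eq0.
move=> U iU UW; have [Uc U0 Ul Ur] := iU.
have UZ a u : U u -> U (a *: u) by move=> Uu; rewrite -[_ *: _]addr0; exact: Ul.
have UD u w : U u -> U w -> U (u + w).
  by move=> Uu Uw; rewrite -[u]scale1r; exact: Ul.
have vv : hdot v v = 1 by rewrite -sqr_hnorm v1 expr1n.
have Uproj u : U u -> U (hdot u v *: v).
  move=> Uu; rewrite ((closure_id U).1 Uc); apply/closure_normP => e e0.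
  have [|n [g [gv small]]] := avg (u - hdot u v *: v) e _ e0.
    by rewrite linearBl linearZl_LR /= vv mulr1 subrr.
  exists (n.+1%:R^-1 *: \sum_(i < n.+1) rho (g i) u).
    by apply: UZ; elim/big_ind: _ => // i _; exact: Ur.
  rewrite distrC; move: small; congr (`| _ | < _).
  under eq_bigr do rewrite urepB urepZ gv.
  rewrite sumrB scalerBr sumr_const card_ord -(scaler_nat _ (hdot u v *: v)).
  by rewrite (scalerA _^-1) mulVf ?pnatr_eq0 // scale1r.
have [[u Uu uv]|Uv] := pselect (exists2 u, U u & hdot u v != 0).
  right; apply/seteqP; split => //; apply: cyclic_span_min => //.
  have := UZ (hdot u v)^-1 _ (Uproj u Uu).
  by rewrite scalerA mulVf // scale1r.
left; apply/seteqP; split=> [u Uu|u ->//] /=.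
apply: (orth_closed_span _ (UW u Uu)) => _ [g _ <-].
have -> : hdot u (rho g v) = hdot (rho g^-1%g u) v.
  by rewrite -[RHS](urep_dot hrho g) -(urepM hrho) mulgV (urep1 hrho).
by apply/eqP; apply: contra_notT Uv => ne0; exists (rho g^-1%g u) => //; exact: Ur.
Qed.

End UnitaryRepresentation.

(** * Permutations that displace an initial segment *)

(** For N <= m this exchanges the blocks [0, N) and [m, m + N). *)
Definition swap_blocks (N m j : nat) : nat :=
  if (j < N)%N then (j + m)%N
  else if (m <= j < m + N)%N then (j - m)%N else j.

Lemma swap_blocksK N m : (N <= m)%N -> involutive (swap_blocks N m).
Proof. by move=> Nm j; rewrite /swap_blocks; do !case: ifP; lia. Qed.

Definition block_swap (N i : nat) : symN :=
  SymN (swap_blocksK (leq_pmulr N (ltn0Sn i))) (swap_blocksK (leq_pmulr N (ltn0Sn i))).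

Lemma block_swap_disjoint N i k m n :
  i != k -> (m < N)%N -> (n < N)%N -> block_swap N i m <> block_swap N k n.
Proof. by rewrite /= /swap_blocks => ik mN nN; rewrite mN nN; nia. Qed.

Lemma diag_subproof (s : symN) : (s, s, s) \in trisym_pred.
Proof. by apply/asboolP; rewrite /= mulgV; split; exact: finitary1. Qed.

Definition diag (s : symN) : trisym := Trisym (diag_subproof s).

(** Only the finitely many preimages of 0, ..., N - 1 have to be avoided. *)
Lemma symN_tail (s : symN) N : exists M, forall j, (M <= j)%N -> (N <= s j)%N.
Proof.
exists (\max_(r < N) (symN_inv s r).+1) => j; apply: contraTT; rewrite -!ltnNge => sjN.
by rewrite -[in ltnLHS](symN_funK s j); exact: (leq_bigmax (Ordinal sjN)).
Qed.

(** * Diagonal permutations in the tensor power *)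

Section TensorPower.
Context (R : realType) (X H : hilbertType R) (xi : X) (I : Type) (e : I -> X)
  (i1 : I) (T : (nat -> X) -> H) (rho : trisym -> H -> H).
Hypotheses (xi1 : `|xi| = 1) (ei1 : e i1 = xi).
Hypothesis hT : is_countable_tensor xi e i1 T.
Hypothesis hrho : is_unitary_rep rho.
Hypothesis rho_diag : forall (s : symN) (x : nat -> X),
  (\forall j \near \oo, x j = xi) ->
  rho (diag s) (T x) = T (fun j => x ((s^-1)%g j)).

Let Xi := T (fun=> xi).

Definition tensors_below (N : nat) : set H :=
  T @` [set x | forall j, (N <= j)%N -> x j = xi].

Lemma near_infty_geP (x : nat -> X) :
  (\forall j \near \oo, x j = xi) <-> exists N, forall j, (N <= j)%N -> x j = xi.
Proof.
split=> [[N _ Nx]|[N Nx]]; first by exists N => j; exact: Nx.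
by exists N => // j; exact: Nx.
Qed.

Lemma tensors_belowS N M : (N <= M)%N -> tensors_below N `<=` tensors_below M.
Proof.
by move=> NM _ [x Nx <-]; exists x => // j Mj; apply: Nx; exact: leq_trans Mj.
Qed.

Lemma norm_Xi : `|Xi| = 1.
Proof.
apply/eqP; rewrite -(@eqrXn2 _ 2) ?normr_ge0 // sqr_hnorm expr1n.
by rewrite (@ctensor_dot _ _ _ _ _ _ _ _ hT _ _ 0) ?big_ord0.
Qed.

Lemma rho_Xi s : rho (diag s) Xi = Xi.
Proof. by rewrite rho_diag //; apply/near_infty_geP; exists 0%N. Qed.

(** In each position at least one of the two permuted tensors has the factor
    xi, and the inner product of two factors a, b splits as <a, xi> <xi, b>
    when one of them is the unit vector xi.  Taking the product over all
    positions gives <rho(s) u, Xi> <Xi, rho(s') v>, where unitarity and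
    rho(s) Xi = Xi remove the permutations. *)
Lemma hdot_rho_disjoint N (s s' : symN) u v :
    (forall m n, (m < N)%N -> (n < N)%N -> s m <> s' n) ->
    lin_span (tensors_below N) u -> lin_span (tensors_below N) v ->
  hdot (rho (diag s) u) (rho (diag s') v) = hdot u Xi * hdot Xi v.
Proof.
move=> ss' Nu Nv.
elim/lin_span_ind : Nu => [|a _ w [x Nx <-] IHu]; last first.
  rewrite (urepD hrho) (urepZ hrho) !linearPl /= IHu mulrDl -mulrA; congr (a * _ + _).
  elim/lin_span_ind : Nv => [|b _ z [y Ny <-] IH]; last first.
    rewrite (urepD hrho) (urepZ hrho) !linearPr /= IH mulrDr mulrCA; congr (_ * _ + _).
    rewrite -(urep_dot hrho (diag s) (T x)) -(urep_dot hrho (diag s') Xi) !rho_Xi.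
    rewrite !rho_diag; [|by apply/near_infty_geP; exists N..].
    (* Both permuted tensors must be stationary from a common position on. *)
    have [M sM] := symN_tail s^-1%g N; have [M' sM'] := symN_tail s'^-1%g N.
    have xM j : (maxn M M' <= j)%N -> x (s^-1%g j) = xi.
      by rewrite geq_max => /andP[/sM /Nx].
    have yM j : (maxn M M' <= j)%N -> y (s'^-1%g j) = xi.
      by rewrite geq_max => /andP[_ /sM' /Ny].
    rewrite !(@ctensor_dot _ _ _ _ _ _ _ _ hT _ _ (maxn M M')) //;
      try by move=> j Mj; rewrite ?xM ?yM.
    rewrite -big_split; apply: eq_bigr => j _ /=.
    have xx : hdot xi xi = 1 by rewrite -sqr_hnorm xi1 expr1n.
    have [sj|/Nx ->] := ltnP (s^-1%g j) N; last by rewrite xx mul1r.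
    have [s'j|/Ny ->] := ltnP (s'^-1%g j) N; last by rewrite xx mulr1.
    by case: (ss' _ _ sj s'j); rewrite !symN_invK.
  by rewrite (urep0 hrho) !linear0r mulr0.
by rewrite (urep0 hrho) !linear0l mul0r.
Qed.

Lemma tensors_below_dense u (eps : R[i]) : 0 < eps ->
  exists N, exists2 w, lin_span (tensors_below N) w & `|u - w| < eps.
Proof.
move=> eps0; pose B := (fun k => T (e \o k)) @`
  [set k : nat -> I | \forall j \near \oo, k j = i1].
have B_below : lin_span B `<=` [set w | exists N, lin_span (tensors_below N) w].
  move=> w; elim/lin_span_ind => /= [|a _ v [k [K _ kK] <-] [N Nv]].
    by exists 0%N; exact: lin_span0.
  exists (maxn K N); apply: lin_span_gen.
    exists (e \o k) => // j; rewrite geq_max => /andP[Kj _] /=.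
    by rewrite kK.
  exact: lin_spanS (tensors_belowS (leq_maxr K N)) _ Nv.
have : closed_span B u by rewrite (ctensor_basis hT).2.
by move=> /closure_normP/(_ eps eps0)[w /B_below[N Nw] uw]; exists N, w.
Qed.

(** Approximate u by w as in [tensors_below_dense] and let P be the orthogonal
    projection along [Xi].  Then u = P w + P (u - w): the translates of P w are
    pairwise orthogonal, so their average shrinks like 1 / sqrt n, while the
    average of the translates of P (u - w) has norm at most |u - w|. *)
Lemma averages_small u (eps : R[i]) : hdot u Xi = 0 -> 0 < eps ->
  exists n (g : nat -> trisym), (forall i, rho (g i) Xi = Xi) /\
    `|n.+1%:R^-1 *: \sum_(i < n.+1) rho (g i) u| < eps.
Proof.
move=> uXi eps0; have eps20 : 0 < eps / 2 by rewrite divr_gt0.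
have [N [w Nw uw]] := tensors_below_dense u eps20.
pose P z := z - hdot z Xi *: Xi; have XiXi : hdot Xi Xi = 1.
  by rewrite -sqr_hnorm norm_Xi expr1n.
have NPw : lin_span (tensors_below N) (P w).
  rewrite /P addrC -scaleNr; apply: lin_span_gen => //.
  by exists (fun=> xi).
have [n nP] := complex_archimedean (exprn_ge0 2 (normr_ge0 (P w))) (exprn_gt0 2 eps20).
exists n, (fun i => diag (block_swap N i)); split; first by move=> i; exact: rho_Xi.
rewrite (_ : \sum_(i < _) _ = \sum_(i < n.+1) rho (diag (block_swap N i)) (P w)
    + \sum_(i < n.+1) rho (diag (block_swap N i)) (P (u - w))); last first.
  rewrite -big_split; apply: eq_bigr => i _ /=; rewrite -(urepD hrho).
  congr (rho _ _); rewrite /P linearBl /= uXi sub0r scaleNr opprK.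
  by rewrite addrACA addNr addr0 addrC subrK.
have n0 : 0 < n.+1%:R :> R[i] by rewrite ltr0Sn.
rewrite normrZ gtr0_norm ?invr_gt0 // mulrC ltr_pdivrMr //.
apply: (le_lt_trans (ler_normD _ _)); rewrite [eps]splitr mulrDl.
apply: ltr_leD; last first.
  apply: (le_trans (ler_norm_sum _ _ _)).
  rewrite -[X in _ * X%:R]card_ord mulr_natr -sumr_const; apply: ler_sum => i _.
  rewrite (urep_norm hrho); apply: ltW; apply: le_lt_trans uw.
  exact: norm_reject_le norm_Xi.
rewrite -ltr_sqr ?nnegrE ?normr_ge0 ?(ltW (mulr_gt0 eps20 n0)) //.
rewrite (@norm_sum_orth _ _ _ (fun i => rho (diag (block_swap N i)) (P w))
  `|P w|); last 2 first.
- move=> i k ik; rewrite (hdot_rho_disjoint _ NPw NPw).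
    by rewrite linearBl linearZl_LR /= XiXi mulr1 subrr mul0r.
  by move=> a b; exact: block_swap_disjoint.
- by move=> i; rewrite (urep_norm hrho).
by rewrite [ltRHS]exprMn [ltRHS]mulrC (expr2 n.+1%:R) -mulrA ltr_pM2l.
Qed.

End TensorPower.

Theorem proposition3p14 (R : realType) (Vred Vyellow Vblue X H : hilbertType R)
    (t : Vred -> Vyellow -> Vblue -> X) (xi : X)
    (I : Type) (e : I -> X) (i1 : I) (T : (nat -> X) -> H)
    (rho : trisym -> H -> H)
    (ht : is_hilbert_tensor3 t)
    (hxi : `|xi| = 1)
    (he : orthonormal_basis [set: I] e) (hei1 : e i1 = xi)
    (hT : is_countable_tensor xi e i1 T)
    (hrho : is_unitary_rep rho)
    (hact : is_trisym_action t xi T rho) :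
  is_irreducible_on rho (cyclic_span rho (T (fun=> xi))).
Proof.
have rho_diag s x : (\forall j \near \oo, x j = xi) ->
    rho (diag s) (T x) = T (fun j => x ((s^-1)%g j)).
  exact: (act_diag hact).
apply: irreducible_of_averages => //; first exact: norm_Xi hT.
move=> u eps uXi eps0.
exact: (averages_small hxi hei1 hT hrho rho_diag).
Qed.
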